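(* Let $E^{(i)}=E\big(x^{(i)},u^{(i)}\big)$ be the value of the discretized energy functional at the solution $\big(x^{(i)},u^{(i)}\big)$ obtained after iteration $i$ (with line search) of the GEORCE algorithm. If the starting point $\big(x^{(0)},u^{(0)}\big)$ is feasible, then the sequence $\{E^{(i)}\}_{i>0}$ converges to a (local) minimum of the discretized energy functional over the feasible set (i.e. it converges, and its limit is the value of $E$ at a (local) minimum point).
   Context: Setting. $U\subseteq\mathbb{R}^d$ is open (the domain of a chart), $G$ is a smooth function on $U$ with values in the symmetric positive definite $d\times d$ matrices (a Riemannian metric in local coordinates), $a,b\in U$, and $T$ is the number of subintervals. For $x=(x_0,\dots,x_T)$ and $u=(u_0,\dots,u_{T-1})$, the discretized energy functional is $E(x,u)=\sum_{t=0}^{T-1}u_t^\top G(x_t)u_t$. A pair $(x,u)$ is feasible if $x_{t+1}=x_t+u_t$ for $t=0,\dots,T-1$, $x_0=a$ and $x_T=b$. On feasible pairs $E$ equals $\sum_{t=0}^{T-1}(x_{t+1}-x_t)^\top G(x_t)(x_{t+1}-x_t)$. ''(Local) minimum'' refers to minimizing $E$ over feasible pairs. GEORCE algorithm. Given a feasible $(x^{(i)},u^{(i)})$, put $G_t=G(x_t^{(i)})$ for $t=0,\dots,T-1$ and $\nu_t=\nabla_y\big(u_t^{(i)\top}G(y)u_t^{(i)}\big)\big|_{y=x_t^{(i)}}$ for $t=1,\dots,T-1$. Compute $$\mu_{T-1}=\Big(\sum_{t=0}^{T-1}G_t^{-1}\Big)^{-1}\Big(2(a-b)-\sum_{t=0}^{T-1}G_t^{-1}\sum_{j=t+1}^{T-1}\nu_j\Big),\qquad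 \tilde u_t=-\tfrac12 G_t^{-1}\Big(\mu_{T-1}+\sum_{j=t+1}^{T-1}\nu_j\Big),\ t=0,\dots,T-1.$$ For a step size $\alpha$, let $\tilde x_0=a$, $\tilde x_{t+1}=\tilde x_t+\alpha\tilde u_t+(1-\alpha)u_t^{(i)}$. The line search picks $\alpha^*$ minimizing the energy of the curve $\tilde x_{0:T}$ over $\alpha$ (exact line search). Then $u_t^{(i+1)}=\alpha^*\tilde u_t+(1-\alpha^* )u_t^{(i)}$, $x_0^{(i+1)}=a$, $x_{t+1}^{(i+1)}=x_t^{(i+1)}+u_t^{(i+1)}$. Standing assumptions. All computations are well-defined within the chart: the starting curve has all its points in $U$, and the line search only considers points in $U$. The end points are not conjugate, and the discretization is sufficiently fine that every critical point of the discretized energy functional (over feasible pairs) is a local or global minimum point.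
   Formalization: It is additionally assumed that the curve points visited by the iterates do not accumulate at the boundary of U; without this the claim fails, e.g. when the unique minimising point, approached but never reached by the iterates, is removed from U. *)

(* Defs.v *)
From HB Require Import structures.
From mathcomp Require Import all_boot all_order all_algebra.
From mathcomp Require Import all_classical all_reals all_analysis.

Set Implicit Arguments.
Unset Strict Implicit.
Unset Printing Implicit Defensive.

Import Order.TTheory GRing.Theory Num.Theory.
Import numFieldNormedType.Exports.

Local Open Scope classical_set_scope.
Local Open Scope ring_scope.

(* C^oo on U: every iterated directional derivative is Frechet differentiable
   at every point of U. Values of f outside the open set U play no role. *)
Definition smooth_on (R : realType) (V W : normedModType R) (U : set V)
    (f : V -> W) : Prop :=
  forall (vs : seq V) (x : V), U x ->
    differentiable (foldr (fun v (g : V -> W) (y : V) => 'D_v g y) f vs) x.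

Definition symmetric_posdef (R : realType) (d : nat) (A : 'M[R]_d) : Prop :=
  A^T = A /\ forall v : 'cV[R]_d, v != 0 -> 0 < (v^T *m A *m v) 0 0.

Definition riemannian_metric (R : realType) (d : nat) (U : set 'cV[R]_d)
    (G : 'cV[R]_d -> 'M[R]_d) : Prop :=
  smooth_on U G /\ forall x, U x -> symmetric_posdef (G x).

Definition partial (R : realType) (d : nat) (f : 'cV[R]_d -> R) (k : 'I_d)
    (y : 'cV[R]_d) : R :=
  'D_(delta_mx k 0) f y.

Definition gradient (R : realType) (d : nat) (f : 'cV[R]_d -> R)
    (y : 'cV[R]_d) : 'cV[R]_d :=
  \col_k partial f k y.

(* Christoffel symbol Gamma^k_(ij) of the Levi-Civita connection of G. *)
Definition christoffel (R : realType) (d : nat) (G : 'cV[R]_d -> 'M[R]_d)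
    (k i j : 'I_d) (x : 'cV[R]_d) : R :=
  2^-1 * \sum_(l < d) invmx (G x) k l *
    (partial (fun y => G y j l) i x + partial (fun y => G y i l) j x
     - partial (fun y => G y i j) l x).

(* l-th component of R(d_i, d_j) d_k, with the convention
   R(X, Y) Z = nabla_X nabla_Y Z - nabla_Y nabla_X Z - nabla_[X, Y] Z. *)
Definition curvature (R : realType) (d : nat) (G : 'cV[R]_d -> 'M[R]_d)
    (l i j k : 'I_d) (x : 'cV[R]_d) : R :=
  partial (christoffel G l j k) i x - partial (christoffel G l i k) j x
  + \sum_(m < d) (christoffel G l i m x * christoffel G m j k x
                  - christoffel G l j m x * christoffel G m i k x).

(* Covariant derivative of the vector field J along the curve c. *)
Definition covariant_derivative (R : realType) (d : nat)
    (G : 'cV[R]_d -> 'M[R]_d) (c J : R -> 'cV[R]_d) (s : R) : 'cV[R]_d :=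
  derive1 J s + \col_k \sum_(i < d) \sum_(j < d)
              christoffel G k i j (c s) * derive1 c s i 0 * J s j 0.

Definition geodesic_on (R : realType) (d : nat) (U : set 'cV[R]_d)
    (G : 'cV[R]_d -> 'M[R]_d) (I : set R) (c : R -> 'cV[R]_d) : Prop :=
  forall s, I s ->
    [/\ U (c s), derivable c s 1, derivable (derive1 c) s 1
      & covariant_derivative G c (derive1 c) s = 0].

(* D_s^2 J + R(J, c') c' = 0 *)
Definition jacobi_field_on (R : realType) (d : nat)
    (G : 'cV[R]_d -> 'M[R]_d) (I : set R) (c J : R -> 'cV[R]_d) : Prop :=
  forall s, I s ->
    [/\ derivable J s 1, derivable (covariant_derivative G c J) s 1
      & covariant_derivative G c (covariant_derivative G c J) s
        + \col_l \sum_(i < d) \sum_(j < d) \sum_(k < d)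
            curvature G l i j k (c s)
            * J s i 0 * derive1 c s j 0 * derive1 c s k 0 = 0].

(* Geodesics are parametrised by [0, 1] and, since U is open, extend to an open
   interval ]-e, 1 + e[, on which two-sided derivatives make sense. *)
Definition conjugate_points (R : realType) (d : nat) (U : set 'cV[R]_d)
    (G : 'cV[R]_d -> 'M[R]_d) (a b : 'cV[R]_d) : Prop :=
  exists (e : R) (c J : R -> 'cV[R]_d),
    [/\ 0 < e,
        geodesic_on U G `]- e, 1 + e[ c /\ (c 0 = a /\ c 1 = b),
        jacobi_field_on G `]- e, 1 + e[ c J,
        J 0 = 0 /\ J 1 = 0
      & exists2 s, s \in `[0, 1]%R & J s != 0].

(* A pair (x, u): column t of z.1 is x_t (t = 0, ..., T) and column t of z.2 is
   u_t (t = 0, ..., T - 1). *)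
Definition discrete_pair (R : realType) (d T : nat) : normedModType R :=
  ('M[R]_(d, T.+1) * 'M[R]_(d, T))%type.

(* x_t and x_(t+1) for t < T *)
Definition node (R : realType) (d T : nat) (x : 'M[R]_(d, T.+1)) (t : 'I_T) :
    'cV[R]_d :=
  col (widen_ord (leqnSn T) t) x.

Definition next_node (R : realType) (d T : nat) (x : 'M[R]_(d, T.+1))
    (t : 'I_T) : 'cV[R]_d :=
  col (lift ord0 t) x.

Definition energy (R : realType) (d T : nat) (G : 'cV[R]_d -> 'M[R]_d)
    (z : discrete_pair R d T) : R :=
  \sum_(t < T) ((col t z.2)^T *m G (node z.1 t) *m col t z.2) 0 0.

Definition trajectory (R : realType) (d T : nat) (a : 'cV[R]_d)
    (z : discrete_pair R d T) : Prop :=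
  col ord0 z.1 = a /\
  forall t : 'I_T, next_node z.1 t = node z.1 t + col t z.2.

Definition feasible (R : realType) (d T : nat) (a b : 'cV[R]_d)
    (z : discrete_pair R d T) : Prop :=
  trajectory a z /\ col ord_max z.1 = b.

Definition in_chart (R : realType) (d T : nat) (U : set 'cV[R]_d)
    (z : discrete_pair R d T) : Prop :=
  forall t : 'I_T.+1, U (col t z.1).

Definition global_minimum (R : realType) (d T : nat) (U : set 'cV[R]_d)
    (G : 'cV[R]_d -> 'M[R]_d) (a b : 'cV[R]_d) (z : discrete_pair R d T) :
    Prop :=
  [/\ feasible a b z, in_chart U z
    & forall w : discrete_pair R d T,
        feasible a b w -> in_chart U w -> energy G z <= energy G w].

Definition local_minimum (R : realType) (d T : nat) (U : set 'cV[R]_d)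
    (G : 'cV[R]_d -> 'M[R]_d) (a b : 'cV[R]_d) (z : discrete_pair R d T) :
    Prop :=
  [/\ feasible a b z, in_chart U z
    & \forall w \near z,
        feasible a b w -> in_chart U w -> energy G z <= energy G w].

(* The feasible pairs form an affine space, whose directions are the pairs
   feasible for the end points 0 and 0. *)
Definition critical_point (R : realType) (d T : nat) (U : set 'cV[R]_d)
    (G : 'cV[R]_d -> 'M[R]_d) (a b : 'cV[R]_d) (z : discrete_pair R d T) :
    Prop :=
  [/\ feasible a b z, in_chart U z
    & forall w : discrete_pair R d T,
        feasible 0 0 w -> 'D_w (energy G : discrete_pair R d T -> R) z = 0].

Definition georce_nu (R : realType) (d T : nat) (G : 'cV[R]_d -> 'M[R]_d)
    (z : discrete_pair R d T) (t : 'I_T) : 'cV[R]_d :=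
  gradient (fun y => ((col t z.2)^T *m G y *m col t z.2) 0 0) (node z.1 t).

Definition georce_nu_tail (R : realType) (d T : nat)
    (G : 'cV[R]_d -> 'M[R]_d) (z : discrete_pair R d T) (t : 'I_T) :
    'cV[R]_d :=
  \sum_(j < T | (t < j)%N) georce_nu G z j.

(* mu_(T-1) *)
Definition georce_mu (R : realType) (d T : nat) (G : 'cV[R]_d -> 'M[R]_d)
    (a b : 'cV[R]_d) (z : discrete_pair R d T) : 'cV[R]_d :=
  invmx (\sum_(t < T) invmx (G (node z.1 t)))
  *m (2 *: (a - b)
      - \sum_(t < T) invmx (G (node z.1 t)) *m georce_nu_tail G z t).

Definition georce_control (R : realType) (d T : nat)
    (G : 'cV[R]_d -> 'M[R]_d) (a b : 'cV[R]_d) (z : discrete_pair R d T) :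
    'M[R]_(d, T) :=
  \matrix_(k < d, t < T)
    (- 2^-1 *: (invmx (G (node z.1 t))
                *m (georce_mu G a b z + georce_nu_tail G z t))) k 0.

(* One iteration z -> z' with exact line search: the step size alpha minimises
   the energy among all real step sizes beta for which every point y_t of the
   corresponding curve lies in U. *)
Definition georce_step (R : realType) (d T : nat) (U : set 'cV[R]_d)
    (G : 'cV[R]_d -> 'M[R]_d) (a b : 'cV[R]_d) (z z' : discrete_pair R d T) :
    Prop :=
  let v (s : R) := s *: georce_control G a b z + (1 - s) *: z.2 in
  exists alpha : R,
    [/\ z'.2 = v alpha, trajectory a z', in_chart U z'
      & forall (beta : R) (y : 'M[R]_(d, T.+1)),
          trajectory a ((y, v beta) : discrete_pair R d T) ->
          in_chart U ((y, v beta) : discrete_pair R d T) ->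
          energy G z' <= energy G ((y, v beta) : discrete_pair R d T)].

(* That all computations take place in the chart, also in the limit, is expressed
   by [closure (visited_points z) `<=` U]. This is vacuous for U = R^d. For other
   U it cannot be dropped: deleting from R^d a point approached but never met by
   the iterates leaves every step unchanged but removes the limiting minimum. *)
Definition visited_points (R : realType) (d T : nat)
    (z : nat -> discrete_pair R d T) : set 'cV[R]_d :=
  [set p | exists (i : nat) (t : 'I_T.+1), p = col t (z i).1].

(* Main.v *)
(* Let w(z) be the pair of the update direction: its control part is V = u~ - u,
   its curve part the partial sums of V, so that one iteration minimises the
   energy along z + s w(z). Since 2 G_t u~_t + sum_(j > t) nu_j = - mu does not
   depend on t, the derivative of the energy at z in a feasible direction w' is
   - 2 sum_t V_t^T G_t w'_t. Hence w(z) is a descent direction unless V = 0, in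
   which case z is critical.

   The energies decrease, and the iterates stay in a compact set: once x_t
   ranges in a compact subset of U, the bound u_t^T G(x_t) u_t <= E(z_0) bounds
   u_t, hence x_(t+1). At a cluster point z* the energy equals the limit e of
   the energies. If z* were not critical, some fixed step s would bring the
   energy at z* below e; as z |-> z + s w(z) is continuous, the same s would
   bring it below e at an iterate close to z*, and the exact line search would
   then do so too. *)
Require Import Defs.
From mathcomp Require Import all_boot all_order all_algebra.
From mathcomp Require Import all_classical all_reals all_analysis.

Import Order.TTheory GRing.Theory Num.Theory.
Import numFieldNormedType.Exports.

Local Open Scope classical_set_scope.
Local Open Scope ring_scope.

Set Implicit Arguments.
Unset Strict Implicit.
Unset Printing Implicit Defensive.

(** * Convergence, differentiation and compactness of matrices *)

Section MatrixConvergence.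
Context {R : realType} {T : Type} (F : set_system T) {FF : Filter F}.

Lemma cvg_mxP m n (f : T -> 'M[R]_(m, n)) (l : 'M[R]_(m, n)) :
  (forall i j, f x i j @[x --> F] --> l i j) -> f x @[x --> F] --> l.
Proof.
move=> fl; apply/cvgrPdist_le => /= e e0.
have : \forall x \near F, forall i j, `|l i j - f x i j| <= e.
  by do 2!apply: filter_forall => ?; exact: ((cvgrPdist_le _ _).1 (fl _ _)).
apply: filterS => x lfx.
rewrite /Num.Def.normr/= mx_normrE (bigmax_le _ (ltW e0))//= => -[i j] _ /=.
by rewrite !mxE.
Qed.

Lemma cvg_mx_entry m n (f : T -> 'M[R]_(m, n)) (l : 'M[R]_(m, n)) i j :
  f x @[x --> F] --> l -> f x i j @[x --> F] --> l i j.
Proof.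
move=> fl; apply: (cvg_comp _ (fun M : 'M[R]_(m, n) => M i j) fl).
exact: coord_continuous.
Qed.

Lemma cvg_prodr (I : Type) (r : seq I) (P : pred I) (f : I -> T -> R)
    (l : I -> R) :
  (forall i, P i -> f i x @[x --> F] --> l i) ->
  \prod_(i <- r | P i) f i x @[x --> F] --> \prod_(i <- r | P i) l i.
Proof. by move=> fl; apply: cvg_big => //; exact: mul_continuous. Qed.

Lemma cvg_sumr (V : normedModType R) (I : Type) (r : seq I) (P : pred I)
    (f : I -> T -> V) (l : I -> V) :
  (forall i, P i -> f i x @[x --> F] --> l i) ->
  \sum_(i <- r | P i) f i x @[x --> F] --> \sum_(i <- r | P i) l i.
Proof. by move=> fl; apply: cvg_big => //; exact: add_continuous. Qed.

Lemma cvg_mulmx m n p (f : T -> 'M[R]_(m, n)) (g : T -> 'M[R]_(n, p))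
    (a : 'M[R]_(m, n)) (b : 'M[R]_(n, p)) :
  f x @[x --> F] --> a -> g x @[x --> F] --> b ->
  f x *m g x @[x --> F] --> a *m b.
Proof.
move=> fa gb; apply: cvg_mxP => i j.
under eq_cvg do rewrite mxE; rewrite mxE.
by apply: cvg_sumr => k _; apply: cvgM; exact: cvg_mx_entry.
Qed.

(** Transposes, columns and the submatrices behind cofactors only select or move entries, so one
    entrywise argument serves them all. *)
Lemma cvg_mx_reindex m n p q (f : T -> 'M[R]_(m, n)) (a : 'M[R]_(m, n))
    (g : 'M[R]_(m, n) -> 'M[R]_(p, q))
    (h : 'I_p -> 'I_q -> 'I_m) (k : 'I_p -> 'I_q -> 'I_n) :
  (forall A i j, g A i j = A (h i j) (k i j)) ->
  f x @[x --> F] --> a -> g (f x) @[x --> F] --> g a.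
Proof.
move=> gE fa; apply: cvg_mxP => i j; under eq_cvg do rewrite gE.
by rewrite gE; exact: cvg_mx_entry.
Qed.

Lemma cvg_trmx m n (f : T -> 'M[R]_(m, n)) (a : 'M[R]_(m, n)) :
  f x @[x --> F] --> a -> (f x)^T @[x --> F] --> a^T.
Proof. by apply: cvg_mx_reindex => A i j; rewrite mxE. Qed.

Lemma cvg_col m n (f : T -> 'M[R]_(m, n)) (a : 'M[R]_(m, n)) j :
  f x @[x --> F] --> a -> col j (f x) @[x --> F] --> col j a.
Proof.
apply: (@cvg_mx_reindex _ _ _ _ _ _ (col j) (fun i _ => i) (fun _ _ => j)).
by move=> A i j'; rewrite mxE.
Qed.

Lemma cvg_det n (f : T -> 'M[R]_n) (a : 'M[R]_n) :
  f x @[x --> F] --> a -> \det (f x) @[x --> F] --> \det a.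
Proof.
move=> fa; apply: cvg_sumr => s _; apply: cvgM; first exact: cvg_cst.
by apply: cvg_prodr => i _; exact: cvg_mx_entry.
Qed.

Lemma cvg_invmx n (f : T -> 'M[R]_n) (a : 'M[R]_n) :
  a \in unitmx -> f x @[x --> F] --> a -> invmx (f x) @[x --> F] --> invmx a.
Proof.
move=> ua fa.
have da : \det a != 0 by rewrite -unitfE -unitmxE.
have fu : \forall x \near F, f x \in unitmx.
  near=> x; rewrite unitmxE unitfE; near: x.
  exact: cvgr_neq0 (cvg_det fa) da.
rewrite {2}/invmx ua.
have H : (\det (f x))^-1 *: \adj (f x) @[x --> F] --> (\det a)^-1 *: \adj a.
  apply: cvgZ; first by apply: cvgV => //; exact: cvg_det.
  apply: cvg_mxP => i j; under eq_cvg do rewrite mxE; rewrite mxE.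
  apply: cvgM; first exact: cvg_cst.
  apply: cvg_det.
  apply: (@cvg_mx_reindex _ _ _ _ _ _ (fun A => row' j (col' i A))
    (fun k _ => lift j k) (fun _ l => lift i l)) => // A k l.
  by rewrite !mxE.
(* [invmx] follows the adjugate formula only on invertible matrices, which [f x] eventually is
   because [\det a] is nonzero. *)
apply: cvg_trans H; apply: near_eq_cvg; near=> x.
by rewrite /invmx; have -> : f x \in unitmx by near: x.
Unshelve. all: by end_near. Qed.

End MatrixConvergence.

(** * Directional derivatives of matrix-valued maps *)

Section MatrixDerivatives.
Context {R : realType} {V : normedModType R}.

Lemma is_derive_mxP m n (f : V -> 'M[R]_(m, n)) x v (df : 'M[R]_(m, n)) :
  is_derive x v f df <-> forall i j, is_derive x v (fun y => f y i j) (df i j).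
Proof.
split=> [fdf i j|fdf].
  have dfx : derivable f x v by exact: ex_derive.
  split; first by have /derivable_mxP := dfx.
  have := @derive_val _ _ _ _ _ _ _ fdf.
  by rewrite derive_mx// => <-; rewrite mxE.
have dfx : derivable f x v by apply/derivable_mxP => i j; exact: ex_derive.
split=> //; rewrite derive_mx//; apply/matrixP => i j; rewrite mxE.
exact: derive_val.
Qed.

Lemma is_derive_sumr (W : normedModType R) n (h : 'I_n -> V -> W) x v
    (dh : 'I_n -> W) :
  (forall i, is_derive x v (h i) (dh i)) ->
  is_derive x v (fun y => \sum_(i < n) h i y) (\sum_(i < n) dh i).
Proof.
move=> /is_derive_sum; congr is_derive.
by apply/funext => y; rewrite fct_sumE.
Qed.

Lemma is_derive_mulmx m n p (f : V -> 'M[R]_(m, n)) (g : V -> 'M[R]_(n, p))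
    x v (df : 'M[R]_(m, n)) (dg : 'M[R]_(n, p)) :
  is_derive x v f df -> is_derive x v g dg ->
  is_derive x v (fun y => f y *m g y) (df *m g x + f x *m dg).
Proof.
move=> /is_derive_mxP fdf /is_derive_mxP gdg; apply/is_derive_mxP => i j.
under eq_fun do rewrite mxE.
rewrite !mxE -big_split/=; apply: is_derive_sumr => k.
apply: is_derive_eq (is_deriveM (fdf i k) (gdg k j)) _.
by rewrite addrC; congr (_ + _); rewrite mulrC.
Qed.

(** By linearity of [L] both difference quotients are the same function of [h]. The maps [L] in view
    are the projections of a pair onto one node or one control. *)
Lemma is_derive_comp_linear (V' W : normedModType R) (L : V -> V')
    (f : V' -> W) x v df : linear L ->
  is_derive (L x) (L v) f df -> is_derive x v (f \o L) df.
Proof.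
move=> Llin.
suff E : (fun h : R => h^-1 *: (((f \o L) \o shift x) (h *: v) - (f \o L) x)) =
         (fun h : R => h^-1 *: ((f \o shift (L x)) (h *: L v) - f (L x))).
  by move=> [dfx <-]; split; rewrite /derivable /derive E.
by apply/funext => h /=; rewrite Llin.
Qed.

Lemma is_derive_linear (W : normedModType R) (L : V -> W) x v :
  linear L -> is_derive x v L (L v).
Proof.
by move=> Llin; apply: (@is_derive_comp_linear W W L id).
Qed.

End MatrixDerivatives.

(** * Compactness in spaces of matrices *)

Section MatrixCompactness.
Context {R : realType}.

Lemma mx_norm_le m n (A : 'M[R]_(m, n)) (M : R) : 0 <= M ->
  (`|A| <= M) = [forall i, forall j, `|A i j| <= M].
Proof.
move=> M0; rewrite /Num.Def.normr/= mx_normrE.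
apply/idP/idP => [AM|/forallP AM].
  apply/forallP => i; apply/forallP => j; apply: le_trans AM.
  exact: (le_bigmax _ (fun ij : 'I_m * 'I_n => `|A ij.1 ij.2|) (i, j)).
by rewrite (bigmax_le _ M0)//= => -[i j] _; exact: (forallP (AM i)).
Qed.

Lemma mx_entry_le_norm m n (A : 'M[R]_(m, n)) i j : `|A i j| <= `|A|.
Proof.
by have := lexx `|A|; rewrite mx_norm_le// => /forallP/(_ i)/forallP.
Qed.

(** The norm is the largest absolute value of an entry, so [vec_mx] carries the box of row vectors
    with sides [[- M, M]], compact by [rV_compact], continuously onto the ball. *)
Lemma mx_closed_ball_compact m n (M : R) :
  compact [set A : 'M[R]_(m, n) | `|A| <= M].
Proof.
have [M0|M0] := ltP M 0.
  rewrite (_ : mkset _ = set0); first exact: compact0.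
  rewrite -subset0 => A /= AM.
  by have := le_lt_trans AM M0; rewrite normr_lt0.
rewrite (_ : mkset _ = vec_mx @`
    [set v : 'rV[R]_(m * n) | forall i, `[- M, M]%classic (v ord0 i)]).
  apply: continuous_compact.
    apply: continuous_subspaceT => v; apply: (@cvg_mxP _ _ (nbhs v)) => i j.
    by under eq_cvg do rewrite mxE; rewrite mxE; exact: coord_continuous.
  apply: (@rV_compact R _ (fun=> `[- M, M]%classic)) => _.
  exact: segment_compact.
apply/seteqP; split=> [A /=|_ [v /= vM <-]].
  rewrite mx_norm_le// => /forallP AM; exists (mxvec A); last by rewrite mxvecK.
  case/mxvec_indexP => i j; rewrite mxvecE /= in_itv/= -ler_norml.
  exact: (forallP (AM i)).
rewrite mx_norm_le//; apply/forallP => i; apply/forallP => j.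
by rewrite mxE ler_norml; have := vM (mxvec_index i j); rewrite /= in_itv.
Qed.

Lemma mx_bounded_preimage_closedact m n (A : set 'M[R]_(m, n)) (M : R) :
  closed A -> (forall x, A x -> `|x| <= M) -> compact A.
Proof.
move=> Acl AM; exact: subclosed_compact Acl (@mx_closed_ball_compact m n M) AM.
Qed.

End MatrixCompactness.

(** * Positive definite matrices *)

Section PositiveDefinite.
Context {R : realType} {d : nat}.
Implicit Types (A : 'M[R]_d) (v : 'cV[R]_d).

(** For [A] the metric at a node this is a summand of [energy], and as a function of the base point
    it is what [georce_nu] differentiates; both identifications hold by conversion. *)
Definition quad A v : R := (v^T *m A *m v) 0 0.

Lemma quadZ A (c : R) v : quad A (c *: v) = c ^+ 2 * quad A v.
Proof.
by rewrite /quad [(c *: v)^T]linearZ/= -!scalemxAl -scalemxAr !mxE expr2 mulrA.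
Qed.

Lemma quad0 A : quad A 0 = 0.
Proof. by rewrite /quad mulmx0 mxE. Qed.

Lemma posdef_quad_ge0 A v : symmetric_posdef A -> 0 <= quad A v.
Proof.
by move=> [_ A0]; have [->|/A0/ltW//] := eqVneq v 0; rewrite quad0.
Qed.

Lemma posdef_unitmx A : symmetric_posdef A -> A \in unitmx.
Proof.
move=> [_ A0]; rewrite -row_free_unit; apply/inj_row_free => v vA.
apply: contraTeq isT => v0.
have /A0 : v^T != 0.
  by apply: contra_neq v0 => /(congr1 trmx); rewrite trmxK trmx0.
by rewrite trmxK vA mul0mx mxE ltxx.
Qed.

(** Substitute [v = A w]: by symmetry of [A], the form of the inverse at [v] is the form of [A] at
    [w]. *)
Lemma posdef_invmx A : symmetric_posdef A -> symmetric_posdef (invmx A).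
Proof.
move=> /[dup] /posdef_unitmx Au [At A0]; split; first by rewrite trmx_inv At.
move=> v v0; have := A0 (invmx A *m v).
rewrite trmx_mul trmx_inv At mulmxKV// mulmxA; apply.
by apply: contra_neq v0 => /(congr1 (mulmx A)); rewrite mulKVmx// mulmx0.
Qed.

(** One summand gives strictness, whence [0 < n]. This makes the matrix inverted in [georce_mu] a
    unit. *)
Lemma posdef_sum (n : nat) (A : 'I_n -> 'M[R]_d) : (0 < n)%N ->
  (forall i, symmetric_posdef (A i)) -> symmetric_posdef (\sum_i A i).
Proof.
move=> n0 Apd; split.
  by rewrite raddf_sum; apply: eq_bigr => i _; case: (Apd i).
move=> v v0; rewrite mulmx_sumr mulmx_suml summxE.
rewrite (bigD1 (Ordinal n0))//= ltr_wpDr//.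
  by apply: sumr_ge0 => i _; exact: posdef_quad_ge0.
by case: (Apd (Ordinal n0)) => _; exact.
Qed.

Lemma cvg_quad (T : Type) (F : set_system T) (f : T -> 'M[R]_d)
    (g : T -> 'cV[R]_d) (A : 'M[R]_d) v : Filter F ->
  f x @[x --> F] --> A -> g x @[x --> F] --> v ->
  quad (f x) (g x) @[x --> F] --> quad A v.
Proof.
move=> FF fA gv; apply: cvg_mx_entry; apply: cvg_mulmx => //.
by apply: cvg_mulmx => //; exact: cvg_trmx.
Qed.

(** The form attains a minimum on the compact product of [K] with the unit sphere, positive by
    definiteness; homogeneity of degree two extends the bound to all [v]. *)
Lemma posdef_compact_lower_bound (X : topologicalType) (K : set X)
    (G : X -> 'M[R]_d) :
  compact K -> {in K, continuous G} ->
  (forall x, K x -> symmetric_posdef (G x)) ->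
  exists2 c, 0 < c & forall x v, K x -> c * `|v| ^+ 2 <= quad (G x) v.
Proof.
move=> Kc Gc Gpd.
pose S := [set v : 'cV[R]_d | `|v| = 1].
have Sc : compact S.
  apply: (@mx_bounded_preimage_closedact _ _ _ _ 1) => [|v ->//].
  rewrite (_ : S = Num.norm @^-1` [set 1])//.
  apply: preimage_closed => [v _|]; first exact: norm_continuous.
  exact: closed_eq.
have Svn v : v != 0 -> S (`|v|^-1 *: v).
  by move=> v0; rewrite /S/= normrZ normfV normr_id mulVf// normr_eq0.
have vE v : v != 0 -> v = `|v| *: (`|v|^-1 *: v).
  by move=> v0; rewrite scalerA divff ?scale1r// normr_eq0.
(* The product is empty if [K] is empty or [d = 0]; then no nonzero [v] has to be bounded and the
   constant 1 serves. *)
have [[[x0 v0]]|KS0] := pselect (K `*` S !=set0); last first.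
  exists 1 => // x v Kx; have [->|v0] := eqVneq v 0.
    by rewrite quad0 normr0 expr0n mulr0.
  by case: KS0; exists (x, `|v|^-1 *: v); split => //; exact: Svn.
move=> KS; have [|p pKS pmin] := @compact_EVT_min _ R
    (fun p => quad (G p.1) p.2) (K `*` S)
    (ex_intro _ _ KS) (compact_setX Kc Sc).
  apply: continuous_in_subspaceT => -[x v] /set_mem[/= /mem_set Kx _].
  apply: cvg_quad; last exact: cvg_snd.
  by apply: (cvg_comp _ G) (Gc _ Kx); exact: cvg_fst.
have {pKS} [Kp Sp] := set_mem pKS.
exists (quad (G p.1) p.2).
  case: (Gpd _ Kp) => _; apply; apply/eqP => p0.
  by move: Sp; rewrite /S/= p0 normr0 => /esym/eqP; rewrite oner_eq0.
move=> x v Kx; have [->|v0'] := eqVneq v 0.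
  by rewrite quad0 normr0 expr0n mulr0.
rewrite {2}(vE v v0') quadZ mulrC ler_wpM2l ?sqr_ge0//.
by apply: (pmin (x, _)); apply/mem_set; split => //; exact: Svn.
Qed.

End PositiveDefinite.

(** * Discrete trajectories and the GEORCE direction *)

Section Trajectories.
Context {R : realType} {d T : nat}.
Implicit Types (a : 'cV[R]_d) (u : 'M[R]_(d, T)) (z : discrete_pair R d T).

(** Solving the recursion makes the curve an affine function of the controls; uniqueness, linearity
    and the end-point condition are read off from this form. *)
Lemma trajectoryP a z : trajectory a z <->
  forall t : 'I_T.+1, col t z.1 = a + \sum_(j < T | (j < t)%N) col j z.2.
Proof.
split=> [[z0 zS] [t tT]|zE].
  elim: t tT => [|t IH] tT /=.
    rewrite big_pred0// addr0 -z0; congr (col _ _); exact: val_inj.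
  have tT' : (t < T)%N by [].
  have -> : col (Ordinal tT) z.1 = next_node z.1 (Ordinal tT').
    by congr (col _ _); exact: val_inj.
  have tT1 : (t < T.+1)%N by exact: ltnW.
  rewrite zS (bigD1 (Ordinal tT'))//= [X in a + X]addrC addrA; congr (_ + _).
  rewrite /node (_ : widen_ord _ _ = Ordinal tT1); last exact: val_inj.
  rewrite IH; congr (_ + _); apply: eq_bigl => j /=.
  by rewrite ltnS -val_eqE/= ltn_neqAle andbC.
split=> [|t]; first by rewrite zE big_pred0 ?addr0.
rewrite /next_node /node !zE -addrA; congr (_ + _) => /=.
rewrite (bigD1 t)/=; last by rewrite /bump.
rewrite addrC; congr (_ + _); apply: eq_bigl => j.
by rewrite /bump/= add1n ltnS -val_eqE/= [RHS]ltn_neqAle andbC.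
Qed.

Lemma feasibleP a b z : trajectory a z ->
  feasible a b z <-> \sum_(j < T) col j z.2 = b - a.
Proof.
move=> /[dup] tz /trajectoryP zE.
have zT : col ord_max z.1 = a + \sum_(j < T) col j z.2.
  by rewrite zE; congr (_ + _); apply: eq_bigl => j; exact: ltn_ord.
split=> [[_]|zb]; first by rewrite zT => <-; rewrite addrC addKr.
by split=> //; rewrite zT zb addrC subrK.
Qed.

Lemma trajectory_inj a z z' :
  trajectory a z -> trajectory a z' -> z.2 = z'.2 -> z = z'.
Proof.
case: z z' => [x u] [x' u'] /trajectoryP/= xE /trajectoryP/= x'E uu'.
congr pair => //; apply/matrixP => k t.
rewrite -uu' in x'E.
by have /matrixP/(_ k 0) := etrans (xE t) (esym (x'E t)); rewrite !mxE.
Qed.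

Lemma trajectoryDZ a z w (s : R) :
  trajectory a z -> trajectory 0 w -> trajectory a (z + s *: w).
Proof.
move=> /trajectoryP zE /trajectoryP wE; apply/trajectoryP => t.
have -> : col t (z + s *: w).1 = col t z.1 + s *: col t w.1.
  by apply/matrixP => i j; rewrite !mxE.
rewrite zE wE add0r scaler_sumr -addrA -big_split/=; congr (_ + _).
by apply: eq_bigr => j _; apply/matrixP => k l; rewrite !mxE.
Qed.

(** The closed form of [trajectoryP] is used as definition, so that continuity in [u] is that of
    finite sums. *)
Definition rollout a u : 'M[R]_(d, T.+1) :=
  \matrix_(k, t) (a + \sum_(j < T | (j < t)%N) col j u) k 0.

Lemma rollout_trajectory a u :
  trajectory a ((rollout a u, u) : discrete_pair R d T).
Proof.
by apply/trajectoryP => t; apply/matrixP => k l; rewrite (ord1 l) !mxE.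
Qed.

End Trajectories.

(** * Directional derivatives of the metric *)

Section Metric.
Context {R : realType} {d : nat} (U : set 'cV[R]_d) (G : 'cV[R]_d -> 'M[R]_d).
Hypothesis G_metric : riemannian_metric U G.

Lemma metric_posdef x : U x -> symmetric_posdef (G x).
Proof. by case: G_metric => _; exact. Qed.

Lemma metric_differentiable x : U x -> differentiable G x.
Proof. by case: G_metric => Gs _; exact: (Gs [::]). Qed.

Lemma metric_continuous x : U x -> {for x, continuous G}.
Proof.
move=> Ux; apply: differentiable_continuous; exact: metric_differentiable.
Qed.

(** The one-element list in [smooth_on] makes first derivatives differentiable, hence continuous;
    the continuity of [georce_nu] rests on this. *)
Lemma metric_derive_continuous v x : U x -> {for x, continuous ('D_v G)}.
Proof.
case: G_metric => Gs _ Ux; apply: differentiable_continuous.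
exact: (Gs [:: v]).
Qed.

Lemma is_derive_quad_metric u v x : U x ->
  is_derive x v (fun y => quad (G y) u) (quad ('D_v G x) u).
Proof.
move=> Ux.
have dG : is_derive x v G ('D_v G x).
  by apply/derivableP/diff_derivable; exact: metric_differentiable.
have : is_derive x v (fun y => u^T *m G y *m u)
    ((0 *m G x + u^T *m 'D_v G x) *m u + u^T *m G x *m 0).
  exact: is_derive_mulmx (is_derive_mulmx (is_derive_cst _ _ _) dG)
    (is_derive_cst _ _ _).
by rewrite mul0mx add0r mulmx0 addr0 => /is_derive_mxP/(_ 0 0).
Qed.

Lemma gradient_quad_metric u x : U x ->
  gradient (fun y => quad (G y) u) x = \col_k quad ('D_(delta_mx k 0) G x) u.
Proof.
move=> Ux; apply/matrixP => k l; rewrite !mxE /partial.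
by have [_ ->] := is_derive_quad_metric u (delta_mx k 0) Ux.
Qed.

(** The differential of [G] is linear in the direction, so expanding [v] in the standard basis
    produces the components of the gradient. *)
Lemma quad_derive_metric u v x : U x ->
  quad ('D_v G x) u = ((gradient (fun y => quad (G y) u) x)^T *m v) 0 0.
Proof.
move=> Ux; rewrite gradient_quad_metric// mxE.
rewrite deriveE; last exact: metric_differentiable.
rewrite {1}[v]matrix_sum_delta linear_sum/= /quad mulmx_sumr mulmx_suml summxE.
apply: eq_bigr => k _.
rewrite big_ord1 linearZ/= -scalemxAr -scalemxAl !mxE mulrC.
by rewrite deriveE//; exact: metric_differentiable.
Qed.

End Metric.

(** * The derivative of the energy and the update direction *)

Section Georce.
Context {R : realType} {d T : nat} (U : set 'cV[R]_d) (G : 'cV[R]_d -> 'M[R]_d).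
Variables (a b : 'cV[R]_d).
Hypothesis G_metric : riemannian_metric U G.
Implicit Types z w : discrete_pair R d T.

Lemma energy_quad z :
  energy G z = \sum_(t < T) quad (G (node z.1 t)) (col t z.2).
Proof. by []. Qed.

Lemma in_chart_node z t : in_chart U z -> U (node z.1 t).
Proof. by move=> zU; exact: zU. Qed.

Lemma posdef_node z t : in_chart U z -> symmetric_posdef (G (node z.1 t)).
Proof. by move=> zU; apply: (metric_posdef G_metric); exact: in_chart_node. Qed.

Lemma quad_node_ge0 z t (v : 'cV[R]_d) :
  in_chart U z -> 0 <= quad (G (node z.1 t)) v.
Proof. by move=> zU; apply: posdef_quad_ge0; exact: posdef_node. Qed.

Lemma energy_ge0 z : in_chart U z -> 0 <= energy G z.
Proof. by move=> zU; apply: sumr_ge0 => t _; exact: quad_node_ge0. Qed.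

(** Product rule: symmetry of the metric merges the two derivatives in the control into [2 G u], and
    the derivative in the node gives [georce_nu] through [quad_derive_metric]. *)
Lemma is_derive_energy z w : in_chart U z ->
  is_derive z w (energy G) (\sum_(t < T)
    ((2 *: (G (node z.1 t) *m col t z.2))^T *m col t w.2
      + (georce_nu G z t)^T *m node w.1 t) 0 0).
Proof.
move=> zU; rewrite /energy; apply: is_derive_sumr => t.
set u := col t z.2; set x := node z.1 t.
have Ux : U x by exact: in_chart_node.
have dG : is_derive z w (fun y => G (node y.1 t)) ('D_(node w.1 t) G x).
  apply: (@is_derive_comp_linear _ _ _ _
    (fun y : discrete_pair R d T => node y.1 t)).
    by move=> c y y'; apply/matrixP => i j; rewrite !mxE.
  by apply/derivableP/diff_derivable; exact: (metric_differentiable G_metric).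
have du : is_derive z w (fun y => col t y.2) (col t w.2).
  apply: is_derive_linear => c y y'.
  by apply/matrixP => i j; rewrite !mxE.
have dut : is_derive z w (fun y => (col t y.2)^T) (col t w.2)^T.
  apply: (@is_derive_linear _ _ _
    (fun y : discrete_pair R d T => (col t y.2)^T)) => c y y'.
  by apply/matrixP => i j; rewrite !mxE.
have /is_derive_mxP/(_ 0 0) := is_derive_mulmx (is_derive_mulmx dut dG) du.
move=> /is_derive_eq; apply; rewrite -/u -/x.
have Gs : (G x)^T = G x by case: (posdef_node t zU).
rewrite mulmxDl [RHS]mxE [in RHS]addrC -(quad_derive_metric G_metric)//.
rewrite [LHS]mxE [X in X + _]mxE -addrA addrC -addrA; congr (_ + _).
rewrite linearZ/= trmx_mul Gs.
have -> : ((col t w.2)^T *m G x *m u) 0 0 = (u^T *m G x *m col t w.2) 0 0.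
  rewrite -[in RHS]Gs -[in RHS](trmxK (col t w.2)) -trmx_mul -mulmxA.
  by rewrite -trmx_mul [RHS]mxE.
by rewrite -scalemxAl [RHS]mxE mulr_natl mulr2n.
Qed.

Lemma node_feasible0 w t : feasible 0 0 w ->
  node w.1 t = \sum_(j < T | (j < t)%N) col j w.2.
Proof. by move=> [/trajectoryP wE _]; rewrite /node wE add0r. Qed.

(** Summation by parts: a node of [w] is the sum of its earlier controls, so exchanging the sums
    charges each control with all later [georce_nu], that is, with the tail. *)
Lemma is_derive_energy_feasible z w : in_chart U z -> feasible 0 0 w ->
  is_derive z w (energy G) (\sum_(t < T)
    ((2 *: (G (node z.1 t) *m col t z.2) + georce_nu_tail G z t)^T
      *m col t w.2) 0 0).
Proof.
move=> zU wf; apply: is_derive_eq (is_derive_energy w zU) _.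
rewrite -!summxE; congr (fun_of_matrix _ 0 0).
under eq_bigr do rewrite (node_feasible0 _ wf).
rewrite big_split/=.
under [RHS]eq_bigr do rewrite linearD/= mulmxDl.
rewrite [RHS]big_split/=; congr (_ + _).
under eq_bigr do rewrite mulmx_sumr big_mkcond/=.
rewrite exchange_big/=; apply: eq_bigr => j _.
by rewrite -big_mkcond/= /georce_nu_tail linear_sum/= mulmx_suml.
Qed.

Definition georce_direction z : discrete_pair R d T :=
  (rollout 0 (georce_control G a b z - z.2), georce_control G a b z - z.2).

Lemma col_georce_control z t : col t (georce_control G a b z) =
  - 2^-1 *: (invmx (G (node z.1 t))
             *m (georce_mu G a b z + georce_nu_tail G z t)).
Proof. by apply/matrixP => k l; rewrite !mxE (ord1 l). Qed.

(** [georce_mu] is chosen for this: multiplied by the sum of the inverse metrics it cancels the tail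
    terms and leaves [2 (a - b)], which the factor [- 1/2] turns into [b - a]. *)
Lemma sum_georce_control z : (0 < T)%N -> in_chart U z ->
  \sum_(t < T) col t (georce_control G a b z) = b - a.
Proof.
move=> T0 zU; under eq_bigr do rewrite col_georce_control mulmxDr.
rewrite -scaler_sumr big_split/= -mulmx_suml mulKVmx; last first.
  apply: posdef_unitmx; apply: posdef_sum => // t.
  by apply: posdef_invmx; exact: posdef_node.
by rewrite subrK scalerA mulNr mulVf ?pnatr_eq0// scaleN1r opprB.
Qed.

Lemma georce_direction_feasible z : (0 < T)%N -> in_chart U z ->
  feasible a b z -> feasible 0 0 (georce_direction z).
Proof.
move=> T0 zU zf; have dt := rollout_trajectory 0 (georce_control G a b z - z.2).
apply/(feasibleP _ dt); have /(feasibleP b) [/(_ zf) zE _] := zf.1.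
under eq_bigr do rewrite linearB/=.
by rewrite sumrB sum_georce_control// zE !subrr.
Qed.

Lemma is_derive_energy_direction z w : in_chart U z -> feasible 0 0 w ->
  is_derive z w (energy G) (- 2 * \sum_(t < T)
    ((col t (georce_direction z).2)^T *m G (node z.1 t) *m col t w.2) 0 0).
Proof.
move=> zU wf; apply: is_derive_eq (is_derive_energy_feasible zU wf) _.
have tailE t : georce_nu_tail G z t =
    - 2 *: (G (node z.1 t) *m col t (georce_control G a b z))
    - georce_mu G a b z.
  rewrite col_georce_control -scalemxAr mulKVmx; last first.
    by apply: posdef_unitmx; exact: posdef_node.
  by rewrite scalerA mulrNN divff ?pnatr_eq0// scale1r addrC addKr.
have w0 : \sum_(t < T) col t w.2 = 0.
  by have [/(feasibleP 0)[/(_ wf)]] := (wf.1, tt); rewrite subrr.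
have gE t : 2 *: (G (node z.1 t) *m col t z.2) + georce_nu_tail G z t =
    - 2 *: (G (node z.1 t) *m col t (georce_direction z).2) - georce_mu G a b z.
  rewrite tailE addrA; congr (_ - _).
  by rewrite [in RHS]linearB/= mulmxBr scalerBr !scaleNr opprK addrC.
under eq_bigr do rewrite gE linearB/= mulmxBl mxE.
(* [georce_mu] does not depend on [t], so it pairs with the sum of the controls of [w], which
   vanishes by [w0]. *)
rewrite big_split/= [X in _ + X](_ : _ = 0) ?addr0; last first.
  by rewrite -summxE sumrN -mulmx_sumr w0 mulmx0 oppr0 mxE.
rewrite mulr_sumr; apply: eq_bigr => t _.
have [Gs _] := posdef_node t zU.
by rewrite linearZ/= trmx_mul Gs -scalemxAl mxE.
Qed.

End Georce.

(** * Continuity of the update direction, descent and line search *)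

Section GeorceContinuity.
Context {R : realType} {d T : nat} (U : set 'cV[R]_d) (G : 'cV[R]_d -> 'M[R]_d).
Variables (a b : 'cV[R]_d).
Hypotheses (U_open : open U) (G_metric : riemannian_metric U G).
Implicit Types z w : discrete_pair R d T.

Lemma cvg_col1 z t : col t y.1 @[y --> z] --> col t z.1.
Proof. by apply: cvg_col; exact: cvg_fst. Qed.

Lemma cvg_col2 z t : col t y.2 @[y --> z] --> col t z.2.
Proof. by apply: cvg_col; exact: cvg_snd. Qed.

Lemma near_in_chart z : in_chart U z -> \forall y \near z, in_chart U y.
Proof.
move=> zU; apply: (@filter_forall _ _ (fun t y => U (col t y.1)) (nbhs z)) => t.
by have := @cvg_col1 z t _ (open_nbhs_nbhs (conj U_open (zU t))).
Qed.

Lemma cvg_metric_node z t : in_chart U z ->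
  G (node y.1 t) @[y --> z] --> G (node z.1 t).
Proof.
move=> zU; apply: (cvg_comp (fun y : discrete_pair R d T => node y.1 t) G
  (@cvg_col1 z _)).
by apply: (metric_continuous G_metric); exact: zU.
Qed.

Lemma cvg_energy z : in_chart U z -> energy G y @[y --> z] --> energy G z.
Proof.
move=> zU; rewrite energy_quad; under eq_cvg do rewrite energy_quad.
apply: cvg_sumr => t _.
by apply: cvg_quad; [exact: cvg_metric_node|exact: cvg_col2].
Qed.

Lemma cvg_georce_nu z t : in_chart U z ->
  georce_nu G y t @[y --> z] --> georce_nu G z t.
Proof.
(* The gradient formula holds at nodes in [U], hence for all pairs near [z], which suffices for the
   limit. *)
move=> zU; have nuE : \forall y \near z, (\col_k quad
    ('D_(delta_mx k 0) G (node y.1 t)) (col t y.2) : 'cV[R]_d)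
    = georce_nu G y t.
  apply: filterS (near_in_chart zU) => y yU.
  by rewrite -(gradient_quad_metric G_metric)//; exact: yU.
apply: cvg_trans (near_eq_cvg nuE) _.
rewrite -(nbhs_singleton nuE); apply: cvg_mxP => k l.
under eq_cvg do rewrite mxE; rewrite mxE.
apply: cvg_quad; last exact: cvg_col2.
apply: (cvg_comp (fun y : discrete_pair R d T => node y.1 t)
  ('D_(delta_mx k 0) G) (@cvg_col1 z _)).
by apply: (metric_derive_continuous G_metric); exact: zU.
Qed.

Lemma cvg_invmx_metric z t : in_chart U z ->
  invmx (G (node y.1 t)) @[y --> z] --> invmx (G (node z.1 t)).
Proof.
move=> zU; apply: cvg_invmx; last exact: cvg_metric_node.
by apply: posdef_unitmx; exact: (posdef_node G_metric).
Qed.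

Lemma cvg_georce_nu_tail z t : in_chart U z ->
  georce_nu_tail G y t @[y --> z] --> georce_nu_tail G z t.
Proof. by move=> zU; apply: cvg_sumr => j _; exact: cvg_georce_nu. Qed.

Lemma cvg_georce_mu z : (0 < T)%N -> in_chart U z ->
  georce_mu G a b y @[y --> z] --> georce_mu G a b z.
Proof.
move=> T0 zU; apply: cvg_mulmx.
  apply: cvg_invmx; last by apply: cvg_sumr => t _; exact: cvg_invmx_metric.
  apply: posdef_unitmx; apply: posdef_sum => // t.
  by apply: posdef_invmx; exact: (posdef_node G_metric).
apply: cvgB; first exact: cvg_cst.
apply: cvg_sumr => t _; apply: cvg_mulmx; first exact: cvg_invmx_metric.
exact: cvg_georce_nu_tail.
Qed.

Lemma cvg_georce_control z : (0 < T)%N -> in_chart U z ->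
  georce_control G a b y @[y --> z] --> georce_control G a b z.
Proof.
move=> T0 zU; apply: cvg_mxP => k t; under eq_cvg do rewrite mxE; rewrite mxE.
apply: cvg_mx_entry; apply: cvgZl_tmp; apply: cvg_mulmx.
  exact: cvg_invmx_metric.
by apply: cvgD; [exact: cvg_georce_mu|exact: cvg_georce_nu_tail].
Qed.

Lemma cvg_rollout (X : Type) (F : set_system X) (c : 'cV[R]_d)
    (f : X -> 'M[R]_(d, T)) (u : 'M[R]_(d, T)) : Filter F ->
  f x @[x --> F] --> u -> rollout c (f x) @[x --> F] --> rollout c u.
Proof.
move=> FF fu; apply: cvg_mxP => k t; under eq_cvg do rewrite mxE; rewrite mxE.
apply: cvg_mx_entry; apply: cvgD; first exact: cvg_cst.
by apply: cvg_sumr => j _; exact: cvg_col.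
Qed.

Lemma cvg_georce_direction z : (0 < T)%N -> in_chart U z ->
  georce_direction G a b y @[y --> z] --> georce_direction G a b z.
Proof.
move=> T0 zU.
have uz : georce_control G a b y - y.2 @[y --> z] -->
    georce_control G a b z - z.2.
  by apply: cvgB; [exact: cvg_georce_control|exact: cvg_snd].
have ruz : rollout 0 (georce_control G a b y - y.2) @[y --> z] -->
    rollout 0 (georce_control G a b z - z.2) by exact: cvg_rollout.
exact: (cvg_pair ruz uz).
Qed.

(** The difference quotient has a negative limit, so it is negative for all small [h > 0]; a small
    enough step also stays in the neighbourhood [P], later taken to be the pairs in the chart. *)
Lemma negative_derivative_descent (V : normedModType R) (f : V -> R) x v df
    (P : set V) :
  is_derive x v f df -> df < 0 -> nbhs x P ->
  exists2 s : R, P (x + s *: v) & f (x + s *: v) < f x.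
Proof.
move=> [dfx dfE] df0 xP.
have Q : (fun h => h^-1 *: ((f \o shift x) (h *: v) - f x)) @ 0^' --> df.
  by rewrite -dfE.
have lt0 : \forall h \near (0 : R)^'+, h^-1 *: (f (h *: v + x) - f x) < 0.
  exact: cvgr_lt (cvg_dnbhs_at_right Q) _ df0.
have cP : \forall h \near (0 : R)^'+, P (x + h *: v).
  have c : x + h *: v @[h --> (0 : R)] --> x.
    rewrite -[X in _ --> X]addr0 -(scale0r v).
    by apply: cvgD; [exact: cvg_cst|exact: scalel_continuous].
  exact: (cvg_at_right_filter c xP).
near ((0 : R)^'+) => h.
have h0 : 0 < h by near: h; exact: nbhs_right_gt.
exists h; first by near: h.
rewrite -subr_lt0 -(pmulr_rlt0 _ (x := h^-1)) ?invr_gt0// [x + _]addrC.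
by near: h.
Unshelve. all: by end_near. Qed.

Lemma georce_direction_descent z : (0 < T)%N ->
  in_chart U z -> feasible a b z -> ~ critical_point U G a b z ->
  exists2 s : R, in_chart U (z + s *: georce_direction G a b z) &
    energy G (z + s *: georce_direction G a b z) < energy G z.
Proof.
move=> T0 zU zf zncr; set w := georce_direction G a b z.
have wf : feasible 0 0 w by exact: (georce_direction_feasible G_metric).
apply: negative_derivative_descent (near_in_chart zU).
  exact: (is_derive_energy_direction a b G_metric).
rewrite mulNr oppr_lt0 pmulr_rgt0// lt0r sumr_ge0 ?andbT; last first.
  by move=> t _; exact: (quad_node_ge0 G_metric).
(* If the sum vanishes, definiteness kills every control of the direction, and
   [is_derive_energy_direction] then gives derivative 0 in every feasible direction. *)
apply/negP => /eqP w0; apply: zncr; split=> // v vf.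
have [_ ->] := is_derive_energy_direction a b G_metric zU vf.
rewrite big1 ?mulr0// => t _.
suff -> : col t (georce_direction G a b z).2 = 0 by rewrite trmx0 !mul0mx mxE.
apply/eqP/negP => /negP c0; have [_ /(_ _ c0)] := posdef_node G_metric t zU.
rewrite -/w in w0 *; rewrite (_ : _ 0 0 = 0) ?ltxx//.
move/eqP: w0; rewrite psumr_eq0 => [/allP/(_ t)|i _].
  by rewrite mem_index_enum => /(_ isT)/eqP.
exact: (quad_node_ge0 G_metric).
Qed.

(** A curve is determined by its start and its controls, so the curves compared by the line search
    are exactly the points in the chart of the line through [z] along the update direction. *)
Lemma georce_stepP z z' : (0 < T)%N -> in_chart U z -> feasible a b z ->
  georce_step U G a b z z' ->
  [/\ feasible a b z', in_chart U z' &
    forall s : R, in_chart U (z + s *: georce_direction G a b z) ->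
      energy G z' <= energy G (z + s *: georce_direction G a b z)].
Proof.
move=> T0 zU zf [s [z's z't z'U z'min]].
have wf := georce_direction_feasible G_metric T0 zU zf.
have vE (r : R) : r *: georce_control G a b z + (1 - r) *: z.2 =
    (z + r *: georce_direction G a b z).2.
  rewrite /= scalerBl scale1r scalerBr addrC -!addrA; congr (_ + _).
  by rewrite addrC.
have tr (r : R) := trajectoryDZ r zf.1 wf.1.
have z'E : z' = z + s *: georce_direction G a b z.
  by apply: (trajectory_inj z't (tr s)); rewrite z's vE.
split=> // [|r rU].
  split=> //; rewrite z'E.
  have -> : col ord_max (z + s *: georce_direction G a b z).1 =
      col ord_max z.1 + s *: col ord_max (georce_direction G a b z).1.
    by apply/matrixP => i j; rewrite !mxE.
  by rewrite zf.2 wf.2 scaler0 addr0.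
have pE : (((z + r *: georce_direction G a b z).1,
    r *: georce_control G a b z + (1 - r) *: z.2) : discrete_pair R d T) =
    z + r *: georce_direction G a b z by rewrite vE.
by have := z'min r (z + r *: georce_direction G a b z).1; rewrite pE; apply.
Qed.

End GeorceContinuity.

(** * Boundedness of the iterates *)

Section Boundedness.
Context {R : realType} {d T : nat} (U : set 'cV[R]_d) (G : 'cV[R]_d -> 'M[R]_d).
Variables (a : 'cV[R]_d) (z : nat -> discrete_pair R d T) (E0 : R).
Hypotheses (G_metric : riemannian_metric U G).
Hypotheses (z_trajectory : forall i, trajectory a (z i))
  (z_in_chart : forall i, in_chart U (z i))
  (z_energy : forall i, energy G (z i) <= E0)
  (z_closure : closure (visited_points z) `<=` U).

(** The induction goes node by node because the definiteness constant that bounds control [n]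
    depends on a compact set containing the nodes up to [n], for all iterates at once. *)
Lemma bounded_nodes n : exists M : R,
  forall i (t : 'I_T.+1), (t <= n)%N -> `|col t (z i).1| <= M.
Proof.
elim: n => [|n [M zM]].
  exists `|a| => i t; rewrite leqn0 => /eqP t0.
  by rewrite (_ : t = ord0) ?(z_trajectory i).1//; exact: val_inj.
(* Intersecting with the closure of the visited points keeps [K] closed and inside [U], where the
   metric is continuous and definite. *)
pose K := [set x | `|x| <= M] `&` closure (visited_points z).
have K_compact : compact K.
  apply: compact_closedI (@closed_closure _ _).
  exact: mx_closed_ball_compact.
have KU : K `<=` U by move=> x [_ /z_closure].
have zK i (t : 'I_T.+1) : (t <= n)%N -> K (col t (z i).1).
  by move=> tn; split; [exact: zM|apply: subset_closure; exists i, t].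
have [|x Kx|c c0 cG] := @posdef_compact_lower_bound _ _ _ K G K_compact.
- by move=> x /set_mem/KU; exact: (metric_continuous G_metric).
- by apply: (metric_posdef G_metric); exact: KU.
(* The bound [1 + E0 / c] avoids a square root: a norm above 1 is at most its square, hence at most
   [E0 / c]. *)
have uM i (t : 'I_T) : (t <= n)%N -> `|col t (z i).2| <= 1 + E0 / c.
  move=> tn; have cE : c * `|col t (z i).2| ^+ 2 <= E0.
    apply: le_trans (z_energy i).
    apply: le_trans (cG _ _ (zK i (widen_ord (leqnSn T) t) tn)) _.
    rewrite energy_quad (bigD1 t)//= lerDl; apply: sumr_ge0 => s _.
    by apply: (quad_node_ge0 G_metric); exact: z_in_chart.
  have [u1|/ltW u1] := leP `|col t (z i).2| 1.
    apply: le_trans u1 _; rewrite lerDl divr_ge0 ?(ltW c0)//.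
    by apply: le_trans cE; rewrite mulr_ge0 ?sqr_ge0 ?(ltW c0).
  apply: (@le_trans _ _ (E0 / c)); last by rewrite lerDr.
  rewrite ler_pdivlMr// mulrC; apply: le_trans cE; rewrite ler_pM2l//.
  by rewrite expr2 ler_peMl.
(* The maximum keeps the bound on earlier nodes; the new node is node [n] plus control [n]. *)
exists (Num.max M (M + (1 + E0 / c))) => i t.
rewrite leq_eqVlt ltnS => /orP[/eqP tn|/zM tM]; last by rewrite le_max tM.
have nT : (n < T)%N by rewrite -ltnS -tn.
have -> : t = lift ord0 (Ordinal nT) by apply: val_inj; rewrite /= tn.
rewrite -/(next_node _ _) (z_trajectory i).2 le_max; apply/orP; right.
by rewrite (le_trans (ler_normD _ _))// lerD ?zM ?uM.
Qed.

(** Controls are differences of consecutive nodes, so a bound [M] on the nodes bounds them by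
    [M + M]. *)
Lemma sequence_in_compact :
  exists2 K : set (discrete_pair R d T), compact K & forall i, K (z i).
Proof.
have [M zM] := bounded_nodes T.
have {}zM i (t : 'I_T.+1) : `|col t (z i).1| <= M by apply: zM; rewrite -ltnS.
have M0 : 0 <= M by exact: le_trans (zM 0%N ord0).
exists ([set x | `|x| <= M] `*` [set u | `|u| <= M + M]).
  by apply: compact_setX; exact: mx_closed_ball_compact.
have z1M i k (t : 'I_T.+1) : `|(z i).1 k t| <= M.
  apply: le_trans (zM i t).
  by have := mx_entry_le_norm (col t (z i).1) k 0; rewrite mxE.
move=> i; split; rewrite /= mx_norm_le ?addr_ge0//;
  apply/forallP => k; apply/forallP => t//.
have /matrixP/(_ k 0) := (z_trajectory i).2 t.
rewrite !mxE => /eqP; rewrite addrC -subr_eq => /eqP <-.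
by rewrite (le_trans (ler_normB _ _))// lerD.
Qed.

End Boundedness.

(** * Closedness of the feasible set, and convergence *)

Lemma closed_feasible (R : realType) (d T : nat) (a b : 'cV[R]_d) :
  closed [set z : discrete_pair R d T | feasible a b z].
Proof.
(* Feasibility is a system of equations between continuous functions, and each solution set is the
   preimage of 0 under the norm of a difference. *)
have cE (V : normedModType R) (f g : discrete_pair R d T -> V) :
    (forall z, f y @[y --> z] --> f z) -> (forall z, g y @[y --> z] --> g z) ->
    closed [set z | f z = g z].
  move=> fc gc; rewrite (_ : mkset _ = (fun z => `|f z - g z|) @^-1` [set 0]).
    apply: preimage_closed => [z _|]; last exact: closed_eq.
    apply: (@cvg_norm _ _ _ (nbhs z)).
    by apply: (@cvgB _ _ _ (nbhs z)); [exact: fc|exact: gc].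
  apply/seteqP; split => z /= => [->|/eqP]; first by rewrite subrr normr0.
  by rewrite normr_eq0 subr_eq0 => /eqP.
rewrite (_ : mkset _ = [set z : discrete_pair R d T | col ord0 z.1 = a] `&`
  \bigcap_(t : 'I_T) [set z : discrete_pair R d T |
      next_node z.1 t = node z.1 t + col t z.2] `&`
  [set z : discrete_pair R d T | col ord_max z.1 = b]).
  apply: closedI; [apply: closedI|].
  - by apply: cE => z; [exact: cvg_col1|exact: cvg_cst].
  - apply: closed_bigI => t _; apply: cE => z; first exact: cvg_col1.
    by apply: cvgD; [exact: cvg_col1|exact: cvg_col2].
  - by apply: cE => z; [exact: cvg_col1|exact: cvg_cst].
apply/seteqP; split => [w [[w0 wS] wb]|w [[w0 wS] wb]].
  by split=> //; split=> // t _; exact: wS.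
by split=> //; split=> // t; exact: wS.
Qed.

Theorem proposition5 (R : realType) (d T : nat) (U : set 'cV[R]_d)
    (G : 'cV[R]_d -> 'M[R]_d) (a b : 'cV[R]_d)
    (z : nat -> discrete_pair R d T)
    (T_gt0 : (0 < T)%N)
    (U_open : open U)
    (G_metric : riemannian_metric U G)
    (a_U : U a) (b_U : U b)
    (ab_nonconjugate : ~ conjugate_points U G a b)
    (fine_discretization : forall w : discrete_pair R d T,
       critical_point U G a b w ->
       local_minimum U G a b w \/ global_minimum U G a b w)
    (z0_feasible : feasible a b (z 0%N))
    (z0_chart : in_chart U (z 0%N))
    (z_step : forall i : nat, georce_step U G a b (z i) (z i.+1))
    (z_chart : closure (visited_points z) `<=` U) :
  exists w : discrete_pair R d T,
    local_minimum U G a b w /\ energy G (z i) @[i --> \oo] --> energy G w.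
Proof.
have zfU i : feasible a b (z i) /\ in_chart U (z i).
  elim: i => // i [zf zU].
  by have [] := georce_stepP G_metric T_gt0 zU zf (z_step i).
have z_min i := (georce_stepP G_metric T_gt0 (zfU i).2 (zfU i).1 (z_step i)).
have z_dec : nonincreasing_seq (fun i => energy G (z i)).
  (* Step size 0 competes in the line search and leaves the iterate in place. *)
  apply/nonincreasing_seqP => i; have [_ _ /(_ 0)] := z_min i.
  by rewrite scale0r addr0; apply; exact: (zfU i).2.
have z_cvg : cvgn (fun i => energy G (z i)).
  apply: nonincreasing_is_cvgn => //; exists 0 => _ [i _ <-].
  exact: (energy_ge0 G_metric (zfU i).2).
set e := limn (fun i => energy G (z i)).
have e_le i : e <= energy G (z i) by exact: nonincreasing_cvgn_ge.
have [K K_compact zK] := @sequence_in_compact _ _ _ U G a z _ G_metric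
  (fun i => (zfU i).1.1) (fun i => (zfU i).2)
  (fun i => z_dec _ _ (leq0n i)) z_chart.
have z_range (P : set (discrete_pair R d T)) :
    (forall i, P (z i)) -> (z @ \oo) P.
  by move=> Pz; exists 0%N => // i _; exact: Pz.
have [w [_]] := K_compact (z @ \oo) _ (z_range _ zK).
(* The cluster point is the limit of a proper filter [F] finer than [z @ \oo], which does the work
   of a subsequence. *)
rewrite cluster_cvgE => -[F F_proper [Fw zF]].
have F_range (P : set (discrete_pair R d T)) : (forall i, P (z i)) -> F P.
  by move=> /z_range; exact: zF.
have wf : feasible a b w.
  have ff : F [set y | feasible a b y] by apply: F_range => i; case: (zfU i).
  exact: (@closed_cvg _ _ F _ id _ (@closed_feasible R d T a b) ff _ Fw).
have wU : in_chart U w.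
  (* Each node of [w] is a limit of visited points. *)
  move=> t; apply: z_chart.
  apply: (@closed_cvg _ _ F _ (fun y : discrete_pair R d T => col t y.1) _
    (@closed_closure _ _) _ _).
    by apply: F_range => i; apply: subset_closure; exists i, t.
  exact: (cvg_trans (cvg_app _ Fw) (@cvg_col1 _ _ _ w t)).
(* Along [F] the energy tends to [energy G w] by continuity, and to [e] because [F] refines the
   sequence. *)
have Ee : energy G w = e.
  apply: (@cvg_unique R _ (energy G @ F)) => //.
    exact: (cvg_trans (cvg_app (energy G) Fw) (cvg_energy G_metric wU)).
  move=> B /z_cvg zB; exact: zF.
exists w; rewrite Ee; split=> //.
(* Criticality is enough, since a global minimum is in particular a local one. *)
suff /fine_discretization[//|[_ _ w_min]] : critical_point U G a b w.
  by split=> //; apply: filterE => y; exact: w_min.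
apply: contrapT => wncr.
have [s sU] := georce_direction_descent U_open G_metric T_gt0 wU wf wncr.
rewrite Ee => s_lt.
(* The step [s] found at [w] is frozen while the base point varies, so that the descent persists
   near [w]. *)
have sc : y + s *: georce_direction G a b y @[y --> w] -->
    w + s *: georce_direction G a b w.
  have dc : georce_direction G a b y @[y --> w] --> georce_direction G a b w.
    exact: (@cvg_georce_direction _ _ _ U).
  exact: (@cvgD _ _ _ (nbhs w) _ id _ _ _ cvg_id (cvgZl_tmp dc)).
have Ec : energy G (y + s *: georce_direction G a b y) @[y --> w] -->
    energy G (w + s *: georce_direction G a b w).
  exact: (cvg_comp _ _ sc (cvg_energy G_metric sU)).
have F_lt : F [set y | energy G (y + s *: georce_direction G a b y) < e].
  by apply: Fw; exact: cvgr_lt Ec _ s_lt.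
have F_chart : F [set y | in_chart U (y + s *: georce_direction G a b y)].
  exact: Fw (sc _ (near_in_chart U_open sU)).
(* This ensures that the nearby pair picked next is an actual iterate [z i]. *)
have F_z : F (range z) by apply: F_range => i; exists i.
have [y [[/= y_lt y_chart] [i _ yE]]] :=
  filter_ex (filterI (filterI F_lt F_chart) F_z).
move: y_lt y_chart; rewrite -yE => y_lt y_chart.
(* The line search at [z i] does at least as well as [s], so the next energy would fall below the
   limit [e]. *)
have [_ _ /(_ s y_chart) zs] := z_min i.
by have := le_lt_trans (le_trans (e_le i.+1) zs) y_lt; rewrite ltxx.
Qed.
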